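(* Let $m\in\mathbb{N}_{\ge4}$, let $X_1,\dots,X_m$ be nonempty sets, and let $Q\subseteq\prod_{i\in[m]}X_i$ satisfy (P1) and (P2). Then there exist an abelian group $(G,+,0_G)$ and bijections $\pi_i:X_i\to G$, $i\in[m]$, such that for every $(a_1,\dots,a_m)\in\prod_{i\in[m]}X_i$, $$(a_1,\dots,a_m)\in Q\iff \pi_1(a_1)+\cdots+\pi_m(a_m)=0_G.$$ Moreover, suppose $\mathcal{M}\preceq\mathcal{N}$ are first-order structures such that $\mathcal{N}$ is $|\mathcal{M}|^+$-saturated, each $X_i$, $i\in[m]$, is type-definable (respectively, definable) in $\mathcal{N}$ over $\mathcal{M}$, and $Q=F\cap\prod_{i\in[m]}X_i$ for a relation $F$ definable in $\mathcal{N}$ over $\mathcal{M}$. Then, given an arbitrary tuple $\bar e=(e_1,\dots,e_m)\in Q$, we can take $G$ to be type-definable (respectively, definable) and the bijections $\pi_i$, $i\in[m]$, to be definable in $\mathcal{N}$, in both cases only using parameters from $\mathcal{M}$ and $\bar e$, so that $\pi_i(e_i)=0_G$ for all $i\in[m]$.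
   Context: $[m]=\{1,\dots,m\}$. The conditions on $Q\subseteq X_1\times\cdots\times X_m$ are: (P1) For every $i\in[m]$ and every choice of $x_j\in X_j$, $j\in[m]\setminus\{i\}$, there is exactly one $x_i\in X_i$ with $(x_1,\dots,x_m)\in Q$. (P2) For every pair $i\ne j$ in $[m]$, writing elements of $\prod_k X_k$ as $(\bar x,\bar y)$ with $\bar x\in X_i\times X_j$ and $\bar y\in\prod_{k\ne i,j}X_k$: for all $\bar x$, $\bar y$, $\bar y'$, if $(\bar x,\bar y)\in Q$ and $(\bar x,\bar y')\in Q$, then for all $\bar x'\in X_i\times X_j$, $(\bar x',\bar y)\in Q\iff(\bar x',\bar y')\in Q$. A set is type-definable in $\mathcal N$ over $\mathcal M$ if it is the set of realizations in $\mathcal N$ of a partial type over $\mathcal M$. A group is type-definable if its underlying set is type-definable and its operations are relatively definable, i.e. their graphs are the traces of definable relations; a map between type-definable sets is called definable if its graph is the trace of a definable relation on the product of its domain and codomain. *)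

(* Defs.v *)
From HB Require Import structures.
From mathcomp Require Import all_boot all_order all_algebra.
From mathcomp Require Import boolp classical_sets functions cardinality.

Set Implicit Arguments.
Unset Strict Implicit.
Unset Printing Implicit Defensive.

Import GRing.Theory.

Local Open Scope classical_set_scope.
Local Open Scope ring_scope.

(* A choice of coordinates outside i (resp. outside i and j) is
   given by a full tuple whose entries at i (resp. i and j) are overwritten,
   hence irrelevant; this is harmless when all the X i are nonempty. *)

Definition P1 (m : nat) (X : 'I_m -> Type) (Q : set (forall i, X i)) : Prop :=
  forall (i : 'I_m) (x : forall j, X j), exists! xi : X i, Q (dfwith x xi).

Definition P2 (m : nat) (X : 'I_m -> Type) (Q : set (forall i, X i)) : Prop :=
  forall i j : 'I_m, i != j ->
  let mk (x : X i * X j) (y : forall k, X k) : forall k, X k :=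
    dfwith (dfwith y x.1) x.2 in
  forall (x : X i * X j) (y y' : forall k, X k),
    Q (mk x y) -> Q (mk x y') ->
    forall x' : X i * X j, Q (mk x' y) <-> Q (mk x' y').

(* One-sorted first-order logic with equality; constants are function symbols
   of arity 0. *)

Record language := Language {
  fsym : Type;
  fary : fsym -> nat;
  rsym : Type;
  rary : rsym -> nat
}.

Record fo_structure (L : language) := FOStructure {
  carrier :> Type;
  carrier_inhabited : inhabited carrier;
  fun_interp : forall f : fsym L, ('I_(fary f) -> carrier) -> carrier;
  rel_interp : forall r : rsym L, set ('I_(rary r) -> carrier)
}.

Inductive term (L : language) (V : Type) : Type :=
| Var of V
| App (f : fsym L) of ('I_(fary f) -> term L V).

(* Formulas with free variables in V; the variable bound by All is None. The
   other connectives are definable, satisfaction being classical. *)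
Inductive formula (L : language) (V : Type) : Type :=
| Bot
| Eq of term L V & term L V
| Rel (r : rsym L) of ('I_(rary r) -> term L V)
| Imp of formula L V & formula L V
| All of formula L (option V).

Fixpoint eval L (N : fo_structure L) V (v : V -> N) (t : term L V) : N :=
  match t with
  | Var x => v x
  | App f ts => fun_interp (fun i => eval v (ts i))
  end.

Fixpoint sat L (N : fo_structure L) V (v : V -> N) (phi : formula L V) : Prop :=
  match phi with
  | Bot => False
  | Eq t u => eval v t = eval v u
  | Rel r ts => rel_interp (fun i => eval v (ts i))
  | Imp p q => sat v p -> sat v q
  | All p => forall x : N, sat (fun o => oapp v x o) p
  end.

Definition elementary_embedding L (M N : fo_structure L) (j : M -> N) : Prop :=
  forall (V : finType) (phi : formula L V) (v : V -> M),
    sat v phi <-> sat (j \o v) phi.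

Definition join (N V W : Type) (v : V -> N) (w : W -> N) : V + W -> N :=
  fun u => match u with inl x => v x | inr y => w y end.

Section Definability.
Context (L : language) (N : fo_structure L) (A : set N).

(* A formula over A in the variables V is a formula in the variables V + A
   whose variables in A are evaluated at themselves. *)
Definition sat_over V (v : V -> N) (phi : formula L (V + A)) : Prop :=
  sat (join v (fun c : A => \val c)) phi.

Definition realizations V (p : set (formula L (V + A))) : set (V -> N) :=
  [set v | forall phi, p phi -> sat_over v phi].

Definition partial_type (V : finType) (p : set (formula L (V + A))) : Prop :=
  forall q, q `<=` p -> finite_set q -> realizations q !=set0.

Definition definable V (D : set (V -> N)) : Prop :=
  exists phi : formula L (V + A), D = [set v | sat_over v phi].

Definition type_definable (V : finType) (D : set (V -> N)) : Prop :=
  exists p : set (formula L (V + A)), partial_type p /\ D = realizations p.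

Definition definable_map V W (X : set (V -> N)) (Y : set (W -> N))
    (f : X -> Y) : Prop :=
  exists D : set (V + W -> N), definable D /\
    forall (x : X) (y : Y), f x = y <-> D (join (\val x) (\val y)).

(* An abelian group with underlying set S is a zmodType class cG on the type S,
   so that the carrier of Pack cG is S itself. The three clauses say that the
   graphs of 0, - and + are traces of definable relations. *)
Definition relatively_definable_ops V (S : set (V -> N)) (cG : Algebra.Zmodule S)
    : Prop :=
  let G : zmodType := Algebra.Zmodule.Pack cG in
  [/\ exists D : set (V -> N), definable D /\
        forall x : S, ((0 : G) = x) <-> D (\val x),
      exists D : set (V + V -> N), definable D /\
        forall x y : S, ((- (x : G) : G) = y) <-> D (join (\val x) (\val y))
    & exists D : set ((V + V) + V -> N), definable D /\
        forall x y z : S, (((x : G) + (y : G) : G) = z) <->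
                          D (join (join (\val x) (\val y)) (\val z))].

End Definability.

(* |K|^+-saturation, |A| < |K|^+ being |A| <= |K|. *)
Definition succ_saturated L (N : fo_structure L) (K : Type) : Prop :=
  forall A : set N, (A #<= [set: K])%card ->
  forall (V : finType) (p : set (formula L (V + A))),
    partial_type p -> realizations p !=set0.

Variant definability := TypeDefinable | Definable.

Definition definable_as (d : definability) L (N : fo_structure L) (A : set N)
    (V : finType) (D : set (V -> N)) : Prop :=
  match d with
  | TypeDefinable => type_definable A D
  | Definable => definable A D
  end.

Definition concat (N : Type) (m : nat) (n : 'I_m -> nat)
    (X : forall i, set ('I_(n i) -> N)) (a : forall i, X i) :
    {i : 'I_m & 'I_(n i)} -> N :=
  fun u => \val (a (tag u)) (tagged u).

(* Main.v *)
Require Import Defs.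
From HB Require Import structures.
From mathcomp Require Import all_boot all_order all_algebra.
From mathcomp Require Import boolp classical_sets functions cardinality.

Set Implicit Arguments.
Unset Strict Implicit.
Unset Printing Implicit Defensive.

Import GRing.Theory.

Local Open Scope classical_set_scope.
Local Open Scope ring_scope.

(** Fix a point e of Q and a coordinate o. By (P1) and (P2), for every j <> o
    the pair of entries (x, y) of a tuple at o and j can be replaced by
    (act x y, e_j) without changing membership in Q, where act x y in X_o does
    not depend on the other entries ([actP]). So each y in X_j acts on X_o, and
    iterating the replacement over all j <> o decides membership in Q.
    The maps act ^~ y from X_o to itself have three properties. Each is proved
    on tuples whose entry at a further coordinate is chosen to put them in Q;
    the first two involve o, j and k already, whence at least four coordinates:
    - those coming from different coordinates j and k commute ([actC]);
    - two of them coming from different coordinates that agree at e_o are equal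
      ([act_base]), so that every coordinate gives the same set of maps;
    - exactly one of them takes a given x to a given x' ([act_injr],
      [act_surjr]).
    So they form a commuting family acting regularly on X_o, which makes X_o an
    abelian group with zero e_o ([group_on_coordinate]). With
    pi_j y = act e_o y and pi_o = id, the iterated replacement says
    that a is in Q iff the sum of the pi_i a_i is zero ([group_of_relation]).

    For the definable version, the natural expression of z = x + y on X_o in
    terms of Q quantifies over the X_i. The group is instead put on the set S
    of triples (pi_0^-1 g, pi_1^-1 (- g), pi_2^-1 (- g)). Each of the conditions
    that defines S, its operations or the maps pi_i then says that a sum of at
    most three terms +-g taken from blocks with different indices vanishes, so
    it is a condition on F with the other coordinates set to e
    ([definable_sum1], [definable_sum2], [definable_sum3]), and no quantifier is
    involved ([definable_group]). *)

(** * Preliminaries *)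

Lemma inj_surj_bijective (T U : Type) (f : T -> U) :
  injective f -> (forall y, exists x, f x = y) -> bijective f.
Proof.
move=> f_inj /choice[g gK]; exists g => // x.
by apply: f_inj; rewrite gK.
Qed.

Lemma zmodule_of_add (T : Type) (zero : T) (opp : T -> T) (add : T -> T -> T) :
  associative add -> commutative add -> left_id zero add ->
  left_inverse zero opp add ->
  exists cG : Algebra.Zmodule T,
    let G : zmodType := Algebra.Zmodule.Pack cG in
    (0 : G) = zero /\ forall x y : G, x + y = add x y.
Proof.
move=> addA addC add0 addN.
pose mE := gen_eqMixin T; pose mC := gen_choiceMixin T.
pose C : choiceType := HB.pack T mE mC.
pose mZ := GRing.isZmodule.Build C addA addC add0 addN.
pose G : zmodType := HB.pack C mZ.
by exists (Algebra.Zmodule.class G).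
Qed.

Lemma fresh_ord (m : nat) (s : seq 'I_m) :
  (size s < m)%N -> exists l, l \notin s.
Proof.
move=> ltsm; apply/existsP; apply: contraLR ltsm => /existsPn s_all.
rewrite -leqNgt -[leqLHS]card_ord (leq_trans _ (card_size s))//.
by apply/subset_leq_card/fintype.subsetP => l _; have /negbNE := s_all l.
Qed.

(** * Overwriting entries of a tuple *)

Section Overwriting.
Context (I : eqType) (X : I -> Type).
Implicit Types (a : forall i, X i) (i j : I).

Lemma dfwith_self a i : dfwith a (a i) = a.
Proof. by apply: functional_extensionality_dep => j; case: dfwithP. Qed.

Lemma dfwithC a i j (x : X i) (y : X j) : i != j ->
  dfwith (dfwith a x) y = dfwith (dfwith a y) x.
Proof.
move=> ij; apply: functional_extensionality_dep => k.
have [<-|jk] := eqVneq j k.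
  by rewrite dfwith_in dfwith_out // dfwith_in.
rewrite dfwith_out //; have [<-|ik] := eqVneq i k.
  by rewrite !dfwith_in.
by rewrite !dfwith_out.
Qed.

End Overwriting.

(** * The group on a coordinate *)

Section Coordinatization.
Context (m : nat) (hm : (4 <= m)%N) (X : 'I_m -> Type).
Context (Q : set (forall i, X i)).
Context (p1 : P1 Q) (p2 : P2 Q) (e : forall i, X i) (Qe : Q e) (o : 'I_m).
Implicit Types (a b : forall i, X i) (i j k l : 'I_m).

Lemma complete i a : exists x : X i, Q (dfwith a x).
Proof. by have [x []] := p1 i a; exists x. Qed.

(** The uniqueness part of (P1). *)
Lemma coord_uniq i a b : Q a -> Q b -> (forall j, i != j -> a j = b j) ->
  a i = b i.
Proof.
move=> Qa Qb ab; have [x [_ xU]] := p1 i a.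
rewrite -(xU (a i)) ?dfwith_self// -(xU (b i))//.
suff -> : dfwith a (b i) = b by [].
apply: functional_extensionality_dep => j; case: dfwithP => //.
Qed.

(** Up to three entries of a member of Q can be prescribed: a coordinate outside
    s is left to be adjusted. *)
Lemma complete_away (s : seq 'I_m) a : (size s < 4)%N ->
  exists b, Q b /\ forall i, i \in s -> b i = a i.
Proof.
move=> s4; have [l ls] := fresh_ord (leq_trans s4 hm).
have [w Qw] := complete l a; exists (dfwith a w); split => // i si.
by rewrite dfwith_out //; apply: contraNneq ls => ->.
Qed.

(** (P2) in transposed form: if two pairs of entries at i and j both complete
    one tuple b to a member of Q, then they complete the same tuples. *)
Lemma exchange i j a b (x x' : X i) (y y' : X j) : i != j ->
  Q (dfwith (dfwith b x) y) -> Q (dfwith (dfwith b x') y') ->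
  Q (dfwith (dfwith a x) y) -> Q (dfwith (dfwith a x') y').
Proof.
by move=> ij Qb Qb' Qa; apply/(p2 ij (x := (x, y)) Qa Qb (x', y')).
Qed.

(** The hypothesis o != j comes after the existential quantifier so that a
    function is available for every j. *)
Lemma collapse j : exists f : X o -> X j -> X o, o != j -> forall x y a,
  Q (dfwith (dfwith a x) y) <-> Q (dfwith (dfwith a (f x y)) (e j)).
Proof.
suff /choice[f fP] : forall xy : X o * X j, exists x' : X o, o != j -> forall a,
    Q (dfwith (dfwith a xy.1) xy.2) <-> Q (dfwith (dfwith a x') (e j)).
  by exists (fun x y => f (x, y)) => oj x y a; exact: (fP (x, y)).
move=> [x y] /=; have [_|oj] := eqVneq o j; first by exists x.
have [b [Qb bE]] :=
  complete_away (s := [:: o; j]) (dfwith (dfwith e x) y) isT.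
have {}Qb : Q (dfwith (dfwith b x) y).
  have -> : x = b o.
    by rewrite bE ?mem_head// dfwith_out ?dfwith_in// eq_sym.
  have -> : y = b j by rewrite bE ?inE ?eqxx ?orbT// dfwith_in.
  by rewrite !dfwith_self.
have [x'] := complete o (dfwith b (e j)).
rewrite dfwithC 1?eq_sym// => Qb'.
by exists x' => _ a; split; apply: (exchange oj); eassumption.
Qed.

(** The action of X_j on X_o: the pair of entries (x, y) at o and j can be
    replaced by (act x y, e_j). It is meaningful for j <> o only. *)
Definition act j : X o -> X j -> X o := projT1 (cid (collapse j)).

Lemma actP j : o != j -> forall a (x : X o) (y : X j),
  Q (dfwith (dfwith a x) y) <-> Q (dfwith (dfwith a (act x y)) (e j)).
Proof. by move=> oj a x y; rewrite /act; case: cid => f /= ->. Qed.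

(** The tuple a after its entries at o and j have been collapsed. *)
Definition step j a := dfwith (dfwith a (act (a o) (a j))) (e j).

Lemma stepP j a : o != j -> Q a <-> Q (step j a).
Proof. by move=> oj; rewrite /step -actP// !dfwith_self. Qed.

Lemma step_mem j a : o != j -> Q a -> Q (step j a).
Proof. by move=> oj /(stepP a oj). Qed.

Lemma step_o j a : o != j -> step j a o = act (a o) (a j).
Proof. by move=> oj; rewrite /step dfwith_out ?dfwith_in// eq_sym. Qed.

Lemma step_in j a : step j a j = e j.
Proof. by rewrite /step dfwith_in. Qed.

Lemma step_out j a i : o != i -> j != i -> step j a i = a i.
Proof. by move=> oi ji; rewrite /step !dfwith_out. Qed.

Lemma act_injr j (x : X o) : o != j -> injective (act x : X j -> X o).
Proof.
move=> oj y y' yy'.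
have [b [Qb bE]] := complete_away (s := [:: o; j]) (dfwith (dfwith e x) y) isT.
have bo : b o = x.
  by rewrite bE ?mem_head// dfwith_out ?dfwith_in// eq_sym.
have bj : b j = y by rewrite bE ?inE ?eqxx ?orbT// dfwith_in.
have Qb' : Q (dfwith b y').
  by rewrite -(dfwith_self b o) bo actP// -yy' -actP// -bo -bj !dfwith_self.
rewrite -bj -(dfwith_in b y'); apply: coord_uniq => // i ij.
by rewrite dfwith_out.
Qed.

Lemma act_surjr j (x v : X o) : o != j -> exists y : X j, act x y = v.
Proof.
move=> oj.
have [b [Qb bE]] := complete_away (s := [:: o; j]) (dfwith e v) isT.
have bo : b o = v by rewrite bE ?mem_head// dfwith_in.
have bj : b j = e j by rewrite bE ?inE ?eqxx ?orbT// dfwith_out.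
have [y] := complete j (dfwith b x); rewrite actP// => Qy; exists y.
rewrite -bo.
have -> : act x y = (dfwith (dfwith b (act x y)) (e j)) o.
  by rewrite dfwith_out ?dfwith_in// eq_sym.
apply: coord_uniq => // i oi; have [<-|ji] := eqVneq j i.
  by rewrite dfwith_in.
by rewrite !dfwith_out.
Qed.

Lemma act_surjl j (y : X j) (v : X o) : o != j -> exists x, act x y = v.
Proof.
move=> oj.
have [b [Qb bE]] := complete_away (s := [:: o; j]) (dfwith e v) isT.
have bo : b o = v by rewrite bE ?mem_head// dfwith_in.
have bj : b j = e j by rewrite bE ?inE ?eqxx ?orbT// dfwith_out.
have [x] := complete o (dfwith b y); rewrite dfwithC 1?eq_sym// actP// => Qx.
exists x; rewrite -bo.
have -> : act x y = (dfwith (dfwith b (act x y)) (e j)) o.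
  by rewrite dfwith_out ?dfwith_in// eq_sym.
apply: coord_uniq => // i oi; have [<-|ji] := eqVneq j i.
  by rewrite dfwith_in.
by rewrite !dfwith_out.
Qed.

(** Both sides are the o-entries of the tuples obtained from a member of Q by
    collapsing j and k in the two possible orders. *)
Lemma actC j k (x : X o) (y : X j) (z : X k) : o != j -> o != k -> j != k ->
  act (act x z) y = act (act x y) z.
Proof.
move=> oj ok jk.
have [a [Qa aE]] := complete_away (s := [:: o; j; k])
  (dfwith (dfwith (dfwith e x) y) z) isT.
have ax : a o = x.
  rewrite aE ?mem_head// dfwith_out 1?eq_sym// dfwith_out 1?eq_sym//.
  by rewrite dfwith_in.
have ay : a j = y.
  by rewrite aE ?inE ?eqxx ?orbT// dfwith_out 1?eq_sym// dfwith_in.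
have az : a k = z by rewrite aE ?inE ?eqxx ?orbT// dfwith_in.
have -> : act (act x z) y = step j (step k a) o.
  by rewrite !step_o// step_out ?ax ?ay ?az// eq_sym.
have -> : act (act x y) z = step k (step j a) o.
  by rewrite !step_o// step_out ?ax ?ay ?az// eq_sym.
apply: coord_uniq => [||i oi].
- by do 2 apply: step_mem => //.
- by do 2 apply: step_mem => //.
have [<-|ji] := eqVneq j i.
  by rewrite step_in step_out ?step_in // eq_sym.
have [<-|ki] := eqVneq k i; first by rewrite step_in step_out// step_in.
by rewrite !step_out.
Qed.

(** If act e_o y = act e_o z, the pairs of entries (y, e_k) and (e_j, z) at j
    and k complete a common tuple, with entry e_o at o, to members of Q. By
    [exchange] they are then interchangeable whatever the entry at o. *)
Lemma act_base j k (x : X o) (y : X j) (z : X k) : o != j -> o != k -> j != k ->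
  act (e o) y = act (e o) z -> act x y = act x z.
Proof.
move=> oj ok jk yz.
have [a [Qa aE]] := complete_away (s := [:: o; j; k]) (dfwith e y) isT.
have ao : a o = e o by rewrite aE ?mem_head// dfwith_out 1?eq_sym.
have aj : a j = y by rewrite aE ?inE ?eqxx ?orbT// dfwith_in.
have ak : a k = e k by rewrite aE ?inE ?eqxx ?orbT// dfwith_out.
(* a' is a with (y, e_k) replaced by (e_j, z) *)
pose a' := dfwith (dfwith a (e j)) z.
have Qa' : Q a'.
  apply/(stepP _ ok); suff -> : step k a' = step j a by apply: step_mem.
  apply: functional_extensionality_dep => i.
  have [<-|oi] := eqVneq o i.
    rewrite !step_o// ao aj yz /a' dfwith_in dfwith_out 1?eq_sym//.
    by rewrite dfwith_out ?ao // eq_sym.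
  have [<-|ki] := eqVneq k i; first by rewrite step_in step_out// ak.
  rewrite step_out// /a' dfwith_out//; have [<-|ji] := eqVneq j i.
    by rewrite dfwith_in step_in.
  by rewrite dfwith_out// step_out.
(* c has (y, e_k) at j and k, and the arbitrary x at o *)
have [c [Qc cE]] := complete_away (s := [:: o; j; k])
  (dfwith (dfwith (dfwith e x) y) (e k)) isT.
have co : c o = x.
  rewrite cE ?mem_head// dfwith_out 1?eq_sym// dfwith_out 1?eq_sym//.
  by rewrite dfwith_in.
have cj : c j = y.
  by rewrite cE ?inE ?eqxx ?orbT// dfwith_out 1?eq_sym// dfwith_in.
have ck : c k = e k by rewrite cE ?inE ?eqxx ?orbT// dfwith_in.
pose c' := dfwith (dfwith c (e j)) z.
have Qc' : Q c'.
  apply: (exchange jk (b := a) (x := y) (y := e k)) => //.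
    by rewrite -aj -ak !dfwith_self.
  by rewrite -cj -ck !dfwith_self.
have -> : act x y = step j c o by rewrite step_o// co cj.
have -> : act x z = step k c' o.
  rewrite step_o// /c' dfwith_in dfwith_out 1?eq_sym// dfwith_out 1?eq_sym//.
  by rewrite co.
apply: coord_uniq => [||i oi]; [exact: step_mem|exact: step_mem|].
have [<-|ki] := eqVneq k i; first by rewrite step_in step_out// ck.
rewrite [RHS]step_out// /c' dfwith_out//; have [<-|ji] := eqVneq j i.
  by rewrite dfwith_in step_in.
by rewrite dfwith_out// step_out.
Qed.

Lemma act_base_id j (x : X o) : o != j -> act x (e j) = x.
Proof.
move=> oj; have [a [Qa aE]] := complete_away (s := [:: o; j]) (dfwith e x) isT.
have ao : a o = x by rewrite aE ?mem_head// dfwith_in.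
have aj : a j = e j by rewrite aE ?inE ?eqxx ?orbT// dfwith_out.
rewrite -ao -aj -step_o//.
apply: coord_uniq => [||i oi] //; first exact: step_mem.
have [<-|ji] := eqVneq j i; first by rewrite step_in.
by rewrite step_out.
Qed.

(** The bijection of X_i with X_o: the identity for i = o, and y |-> act e_o y
    for the other i. *)
Definition coord : forall i, X i -> X o :=
  dfwith (T := fun i => X i -> X o) (fun i => act (e o)) (i := o) id.

Lemma coord_o : coord (i := o) = id.
Proof. by rewrite /coord dfwith_in. Qed.

Lemma coord_out i : o != i -> coord (i := i) = act (e o).
Proof. by move=> oi; rewrite /coord dfwith_out. Qed.

Lemma coord_bij i : bijective (coord (i := i)).
Proof.
have [<-|oi] := eqVneq o i; first by rewrite coord_o; exists id.
rewrite coord_out//; apply: inj_surj_bijective => [|v]; first exact: act_injr.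
exact: act_surjr.
Qed.

Lemma coord_base i : coord (e i) = e o.
Proof.
by have [<-|oi] := eqVneq o i; rewrite ?coord_o// coord_out// act_base_id.
Qed.

(** The sum x + x' is act x' y for the y in X_j with act e_o y = x, where j is
    any coordinate other than o; the law does not depend on j by [act_base]. *)
Lemma group_on_coordinate : exists cG : Algebra.Zmodule (X o),
  let G : zmodType := Algebra.Zmodule.Pack cG in
  (0 : G) = e o /\
  forall i (x : G) (y : X i), o != i -> act x y = (coord y : G) + x.
Proof.
have [j jo] := @fresh_ord m [:: o] (leq_trans (isT : (2 <= 4)%N) hm).
have [k kjo] := @fresh_ord m [:: j; o] (leq_trans (isT : (3 <= 4)%N) hm).
move: jo kjo; rewrite !inE negb_or => jo /andP[kj ko].
have oj : o != j by rewrite eq_sym.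
have ok : o != k by rewrite eq_sym.
(* q x is the y in X_j with act e_o y = x *)
have [q qK Kq] := coord_bij j; rewrite (coord_out oj) in qK Kq.
pose add (x x' : X o) := act x' (q x).
have actE i (x : X o) (y : X i) : o != i -> act x y = add (coord y) x.
  move=> oi; rewrite /add (coord_out oi).
  have [eij|ij] := eqVneq i j; last by apply: act_base => //; rewrite Kq.
  by subst i; rewrite qK.
have add0r x : add x (e o) = x by rewrite /add Kq.
have addCA u v x : add u (add v x) = add v (add u x).
  (* v also comes from the coordinate k, and [actC] applies to j and k *)
  have [z vz] : exists z : X k, act (e o) z = v by apply: act_surjr.
  rewrite -[v]vz -(coord_out ok) -!actE// /add.
  by rewrite [LHS]actC// eq_sym.
have addC : commutative add.
  by move=> x y; rewrite -{1}(add0r y) addCA add0r.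
have addA : associative add.
  by move=> x y z; rewrite (addC y z) addCA (addC z).
have /choice[opp oppP] (x : X o) : exists y, add y x = e o.
  by have [y xy] := act_surjl (q x) (e o) oj; exists y; rewrite addC.
have add0l : left_id (e o) add by move=> x; rewrite addC.
have [cG [zE addE]] := zmodule_of_add addA addC add0l oppP.
by exists cG; split=> // i x y oi; rewrite addE actE.
Qed.

(** The abstract part of the theorem, with the normalization pi_i e_i = 0. *)
Lemma group_of_relation : exists (G : zmodType) (pi : forall i, X i -> G),
  [/\ forall i, bijective (pi i), forall i, pi i (e i) = 0
    & forall a, Q a <-> \sum_(i < m) pi i (a i) = 0].
Proof.
have [cG [zE actE]] := group_on_coordinate.
pose G : zmodType := Algebra.Zmodule.Pack cG.
exists G, coord; split => [i|i|]; first exact: coord_bij.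
  by rewrite coord_base zE.
(* collapse one after the other the coordinates in s, the only ones besides o
   where a may differ from e *)
have sum0 (s : seq 'I_m) a : uniq s -> o \notin s ->
    (forall i, o != i -> i \notin s -> a i = e i) ->
    Q a <-> \sum_(i <- s) (coord (a i) : G) + a o = 0.
  elim: s a => [|k s IHs] a /=.
    move=> _ _ aE; rewrite big_nil add0r zE; split=> [Qa|ao].
      by apply: coord_uniq => // i oi; rewrite aE.
    suff -> : a = e by [].
    apply: functional_extensionality_dep => i.
    by have [<-|oi] := eqVneq o i => //; apply: aE.
  move=> /andP[ks us]; rewrite in_cons negb_or => /andP[ok os] aE.
  rewrite (stepP _ ok) IHs//; last first.
    move=> i oi is_; have [<-|ki] := eqVneq k i; first by rewrite step_in.
    by rewrite step_out// aE// inE negb_or eq_sym ki.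
  rewrite step_o// actE// big_cons addrCA addrA.
  rewrite (eq_big_seq (fun i => coord (a i) : G))// => i si.
  by rewrite step_out//; [apply: contraNneq os|apply: contraNneq ks] => ->.
move=> a; rewrite (bigD1 o)//= addrC coord_o -big_filter.
apply: sum0; rewrite ?filter_uniq ?index_enum_uniq//.
  by rewrite mem_filter eqxx.
by move=> i oi; rewrite mem_filter mem_index_enum eq_sym oi.
Qed.

End Coordinatization.

(** * Renaming the variables of a formula *)

Section Renaming.
Context (L : language).

Fixpoint term_rename (V W : Type) (f : V -> W) (t : term L V) : term L W :=
  match t with
  | Var x => Var L (f x)
  | App g ts => App (fun i => term_rename f (ts i))
  end.

Fixpoint formula_rename (V : Type) (phi : formula L V) :
    forall W : Type, (V -> W) -> formula L W :=
  match phi with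
  | Bot => fun W f => Bot L W
  | Eq t u => fun W f => Eq (term_rename f t) (term_rename f u)
  | Rel r ts => fun W f => Rel (fun i => term_rename f (ts i))
  | Imp p q => fun W f => Imp (formula_rename p f) (formula_rename q f)
  | All p => fun W f => All (formula_rename p (omap f))
  end.

Context (N : fo_structure L).

Lemma eval_rename V W (f : V -> W) (v : W -> N) (t : term L V) :
  eval v (term_rename f t) = eval (v \o f) t.
Proof.
elim: t => //= g ts IHts; congr fun_interp.
by apply: functional_extensionality_dep => i; apply: IHts.
Qed.

Lemma sat_rename V (phi : formula L V) W (f : V -> W) (v : W -> N) :
  sat v (formula_rename phi f) <-> sat (v \o f) phi.
Proof.
elim: phi W f v => {V} [V|V t u|V r ts|V p IHp q IHq|V p IHp] W f v /=.
- by [].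
- by rewrite !eval_rename.
- suff -> : (fun i => eval v (term_rename f (ts i))) =
            (fun i => eval (v \o f) (ts i)) by [].
  by apply: functional_extensionality_dep => i; apply: eval_rename.
- by rewrite IHp IHq.
- have oapp_omap x : (fun o => oapp v x o) \o omap f =
                     (fun o => oapp (v \o f) x o).
    by apply: functional_extensionality_dep; case.
  by split=> p_all x; have := p_all x; rewrite IHp oapp_omap.
Qed.

End Renaming.

(** * Definable and type-definable sets *)

Section CutOut.
Context (L : language) (N : fo_structure L).

(** The set D is definable over A or, for [TypeDefinable], the set of
    realizations of an arbitrary set of formulas over A. The latter is weaker
    than type-definability in that D may be empty and the variables infinitely
    many. *)
Definition cut_out (d : definability) (A : set N) V (D : set (V -> N)) : Prop :=
  match d with
  | TypeDefinable => exists p : set (formula L (V + A)), D = realizations p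
  | Definable => definable A D
  end.

Lemma definable_as_cut_out d A (V : finType) (D : set (V -> N)) :
  definable_as d A D -> cut_out d A D.
Proof. by case: d => // -[p [_ ->]]; exists p. Qed.

(** A realization of a set of formulas witnesses that it is a partial type. *)
Lemma cut_out_definable_as d A (V : finType) (D : set (V -> N)) :
  D !=set0 -> cut_out d A D -> definable_as d A D.
Proof.
case: d => // -[v Dv] [p Dp]; exists p; split=> // q qp _.
by exists v => phi /qp; rewrite Dp in Dv; apply: Dv.
Qed.

Lemma definable_cut_out d A V (D : set (V -> N)) :
  definable A D -> cut_out d A D.
Proof.
case: d => // -[phi ->]; exists [set phi]; apply/seteqP; split=> v /=.
  by move=> vphi _ ->.
exact.
Qed.

Lemma cut_outI d A V (D E : set (V -> N)) :
  cut_out d A D -> cut_out d A E -> cut_out d A (D `&` E).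
Proof.
case: d => /= -[p ->] [q ->].
  exists (p `|` q); apply/seteqP; split=> v.
    by move=> [vp vq] phi [/vp|/vq].
  by move=> vpq; split=> phi ?; apply: vpq; [left|right].
exists (Imp (Imp p (Imp q (Bot L _))) (Bot L _)); apply/seteqP.
split=> v /=; rewrite /sat_over /=; first by move=> [vp vq]; apply.
by move=> vpq; split; apply: contrapT => nv; apply: vpq.
Qed.

(** Substituting variables or parameters from A for the variables of D. *)
Lemma cut_out_subst d (A B : set N) V W (D : set (V -> N)) (s : V -> W + A) :
  B `<=` A -> cut_out d B D ->
  cut_out d A [set w | D (fun v => join w (fun c : A => \val c) (s v))].
Proof.
move=> BA.
pose r (u : V + B) : W + A :=
  match u with
  | inl v => s v
  | inr c => inr (SigSub (mem_set (BA _ (set_mem (valP c)))))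
  end.
have satE phi w : sat_over w (formula_rename phi r) <->
    sat_over (fun v => join w (fun c : A => \val c) (s v)) phi.
  rewrite /sat_over sat_rename; suff -> : join w (fun c : A => \val c) \o r =
      join (fun v => join w (fun c : A => \val c) (s v)) (fun c : B => \val c).
    by [].
  by apply: functional_extensionality_dep; case.
case: d => /= -[p ->]; last first.
  by exists (formula_rename p r); apply/seteqP; split=> w /=; rewrite satE.
exists [set formula_rename phi r | phi in p]; apply/seteqP; split=> w /=.
  by move=> wp _ [phi pphi <-]; rewrite satE; apply: wp.
by move=> wp phi pphi; rewrite -satE; apply: wp; exists phi.
Qed.

End CutOut.

(** * The definable group *)

Section SumRelations.
Context (L : language) (N : fo_structure L) (m : nat) (n : 'I_m -> nat).
Context (X : forall i, set ('I_(n i) -> N)).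
Arguments X : clear implicits.
Context (Q : set (forall i, X i)).
Context (F : set ({i : 'I_m & 'I_(n i)} -> N)) (A B : set N) (BA : B `<=` A).
Context (defF : definable B F) (QF : forall a, Q a <-> F (concat a)).
Context (e : forall i, X i) (eA : range (concat e) `<=` A).
Context (G : zmodType) (pi : forall i, X i -> G).
Arguments pi : clear implicits.
Context (pi_e : forall i, pi i (e i) = 0).
Context (Q_sum : forall a, Q a <-> \sum_(i < m) pi i (a i) = 0).

(** The relation obtained from F by reading the block of variables of each
    coordinate from T: a variable in W, or a parameter in A. *)
Definition trace W (T : forall i, 'I_(n i) -> W + A) : set (W -> N) :=
  [set w | F (fun u => join w (fun c : A => \val c) (T (tag u) (tagged u)))].

Lemma trace_definable W (T : forall i, 'I_(n i) -> W + A) :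
  definable A (trace T).
Proof.
exact: (cut_out_subst (d := Definable)
          (fun u : {i : 'I_m & 'I_(n i)} => T (tag u) (tagged u)) BA defF).
Qed.

(** Under the assignment w, the blocks T spell out the tuple b. *)
Definition reads W (w : W -> N) (T : forall i, 'I_(n i) -> W + A)
    (b : forall i, X i) : Prop :=
  forall i l, join w (fun c : A => \val c) (T i l) = \val (b i) l.

Lemma traceP W (w : W -> N) T b : reads w T b ->
  trace T w <-> \sum_(i < m) pi i (b i) = 0.
Proof.
move=> wTb; rewrite -Q_sum QF /trace /=.
suff -> : (fun u => join w (fun c : A => \val c) (T (tag u) (tagged u))) =
          concat b by [].
by apply: functional_extensionality_dep => u; apply: wTb.
Qed.

(** Every coordinate is read from the parameters e. *)
Definition base_reading W : forall i, 'I_(n i) -> W + A :=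
  fun i l => inr (SigSub (mem_set
    (eA (ex_intro2 _ _ (Tagged (fun i => 'I_(n i)) l) I erefl)))).

Lemma reads_base W (w : W -> N) : reads w (base_reading W) e.
Proof. by []. Qed.

Lemma reads_dfwith W (w : W -> N) T b i (r : 'I_(n i) -> W) (x : X i) :
  reads w T b -> (forall l, w (r l) = \val x l) ->
  reads w (dfwith (T := fun i => 'I_(n i) -> W + A) T (fun l => inl (r l)))
          (dfwith b x).
Proof.
move=> wTb wrx j; have [<-|ij] := eqVneq i j; first by rewrite !dfwith_in.
by rewrite !dfwith_out.
Qed.

Lemma sum_dfwith b i (x : X i) : pi i (b i) = 0 ->
  \sum_(j < m) pi j (dfwith b x j) = pi i x + \sum_(j < m) pi j (b j).
Proof.
move=> bi0; rewrite (bigD1 i)//= dfwith_in [in RHS](bigD1 i)//= bi0 add0r.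
by congr (_ + _); apply: eq_bigr => j ji; rewrite dfwith_out// eq_sym.
Qed.

(** The relation pi_i x = 0, as a definable relation on any assignments in which
    the block r of variables spells out x; similarly below for sums of two and
    three terms. *)
Lemma definable_sum1 W i (r : 'I_(n i) -> W) :
  exists D : set (W -> N), definable A D /\
    forall w (x : X i), (forall l, w (r l) = \val x l) ->
      (D w <-> pi i x = 0).
Proof.
exists (trace (dfwith (base_reading W) (fun l => inl (r l)))).
split=> [|w x wrx]; first exact: trace_definable.
rewrite (traceP (reads_dfwith (reads_base w) wrx)) sum_dfwith//.
by rewrite big1 ?addr0.
Qed.

Lemma definable_sum2 W i j (r : 'I_(n i) -> W) (s : 'I_(n j) -> W) : i != j ->
  exists D : set (W -> N), definable A D /\
    forall w (x : X i) (y : X j), (forall l, w (r l) = \val x l) ->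
      (forall l, w (s l) = \val y l) ->
      (D w <-> pi i x + pi j y = 0).
Proof.
move=> ij.
exists (trace (dfwith (T := fun i => 'I_(n i) -> W + A)
  (dfwith (base_reading W) (fun l => inl (r l))) (fun l => inl (s l)))).
split=> [|w x y wrx wsy]; first exact: trace_definable.
rewrite (traceP (reads_dfwith (reads_dfwith (reads_base w) wrx) wsy)).
rewrite sum_dfwith; last by rewrite dfwith_out.
by rewrite sum_dfwith// big1 ?addr0// addrC.
Qed.

Lemma definable_sum3 W i j k (r : 'I_(n i) -> W) (s : 'I_(n j) -> W)
    (t : 'I_(n k) -> W) : i != j -> i != k -> j != k ->
  exists D : set (W -> N), definable A D /\
    forall w (x : X i) (y : X j) (z : X k), (forall l, w (r l) = \val x l) ->
      (forall l, w (s l) = \val y l) -> (forall l, w (t l) = \val z l) ->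
      (D w <-> pi i x + pi j y + pi k z = 0).
Proof.
move=> ij ik jk.
exists (trace (dfwith (T := fun i => 'I_(n i) -> W + A)
  (dfwith (T := fun i => 'I_(n i) -> W + A)
    (dfwith (base_reading W) (fun l => inl (r l))) (fun l => inl (s l)))
  (fun l => inl (t l)))).
split=> [|w x y z wrx wsy wtz]; first exact: trace_definable.
rewrite (traceP
  (reads_dfwith (reads_dfwith (reads_dfwith (reads_base w) wrx) wsy) wtz)).
rewrite sum_dfwith; last by rewrite !dfwith_out.
rewrite sum_dfwith; last by rewrite dfwith_out.
by rewrite sum_dfwith// big1 ?addr0// addrC [pi j y + _]addrC.
Qed.

Context (pi_bij : forall i, bijective (pi i)) (hm : (3 <= m)%N).
Context (d : definability) (defX : forall i, definable_as d B (X i)).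

(** Given the abstract group G, a definable copy of it lives on a set S of
    assignments of three blocks of variables: the element g is coded by
    [iota g], the concatenation of pi_0^-1 g, pi_1^-1 (- g) and
    pi_2^-1 (- g). *)
Lemma definable_group :
  exists (k : nat) (S : set ('I_k -> N)) (cG : Algebra.Zmodule S),
    let G' : zmodType := Algebra.Zmodule.Pack cG in
    exists pi' : forall i, X i -> G',
      [/\ definable_as d A S,
          relatively_definable_ops A cG,
          forall i, definable_map A (Y := S) (pi' i),
          forall i, bijective (pi' i)
        & (forall a : forall i, X i, Q a <-> \sum_(i < m) pi' i (a i) = 0) /\
          (forall i, pi' i (e i) = 0)].
Proof.
pose i0 : 'I_m := Ordinal (leq_trans (isT : (1 <= 3)%N) hm).
pose i1 : 'I_m := Ordinal (leq_trans (isT : (2 <= 3)%N) hm).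
pose i2 : 'I_m := Ordinal hm.
have [rho rhoK] : exists rho : forall i, G -> X i,
    forall i g, pi i (rho i g) = g.
  have inv i : exists r : G -> X i, forall g, pi i (r g) = g.
    by have [r _ rK] := pi_bij i; exists r.
  exists (fun i => projT1 (cid (inv i))) => i g.
  by case: (cid (inv i)).
have pi_inj i : injective (pi i) by apply: bij_inj.
pose k := (n i0 + (n i1 + n i2))%N.
pose b0 l : 'I_k := lshift _ l.
pose b1 l : 'I_k := rshift _ (lshift _ l).
pose b2 l : 'I_k := rshift _ (rshift _ l).
pose iota (g : G) : 'I_k -> N := fun u =>
  match fintype.split u with
  | inl l => \val (rho i0 g) l
  | inr v =>
    match fintype.split v with
    | inl l => \val (rho i1 (- g)) l
    | inr l => \val (rho i2 (- g)) l
    end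
  end.
have iota0 g l : iota g (b0 l) = \val (rho i0 g) l.
  by rewrite /iota (unsplitK (inl l)).
have iota1 g l : iota g (b1 l) = \val (rho i1 (- g)) l.
  by rewrite /iota (unsplitK (inr (lshift _ l))) (unsplitK (inl l)).
have iota2 g l : iota g (b2 l) = \val (rho i2 (- g)) l.
  by rewrite /iota (unsplitK (inr (rshift _ l))) (unsplitK (inr l)).
pose S := range iota.
pose phi g : S := SigSub (mem_set (ex_intro2 _ _ g I erefl : S (iota g))).
have phi_inj : injective phi.
  move=> g h /(congr1 val)/= gh; rewrite -(rhoK i0 g) -(rhoK i0 h).
  congr (pi _ _); apply: val_inj; apply: functional_extensionality_dep => l.
  by rewrite -iota0 gh iota0.
have phi_bij : bijective phi.
  apply: inj_surj_bijective => // s.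
  by have [g _ gs] := set_mem (valP s); exists g; apply: val_inj.
have [psi phiK psiK] := phi_bij.
(* transport the group structure along the bijection phi : G -> S *)
have [cG [zE addE]] : exists cG : Algebra.Zmodule S,
    let G' : zmodType := Algebra.Zmodule.Pack cG in
    (0 : G') = phi 0 /\ forall x y : G', x + y = phi (psi x + psi y).
  apply: (@zmodule_of_add S (phi 0) (fun s => phi (- psi s))
    (fun s t => phi (psi s + psi t))).
  - by move=> x y z; rewrite !phiK addrA.
  - by move=> x y; rewrite addrC.
  - by move=> x; rewrite phiK add0r psiK.
  - by move=> x; rewrite phiK addNr.
pose G' : zmodType := Algebra.Zmodule.Pack cG.
have phiD (g h : G) : (phi g : G') + phi h = phi (g + h).
  by rewrite addE !phiK.
exists k, S, cG, (fun i x => phi (pi i x)); split.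
- have [D1 [D1d D1P]] := definable_sum2 b0 b1 (isT : i0 != i1).
  have [D2 [D2d D2P]] := definable_sum2 b0 b2 (isT : i0 != i2).
  (* a triple codes an element iff its first entry is opposite to both others *)
  have SE : S = [set w : 'I_k -> N | X i0 (w \o b0)]
                `&` [set w : 'I_k -> N | X i1 (w \o b1)]
                `&` [set w : 'I_k -> N | X i2 (w \o b2)] `&` D1 `&` D2.
    apply/seteqP; split=> [w [g _ <-]|w [[[[X0 X1] X2] w1] w2]].
      have block i (x : X i) f : (forall l, f l = \val x l) -> X i f.
        move=> fx; suff -> : f = \val x by apply/set_mem/valP.
        exact: functional_extensionality_dep.
      split; first split; first split; first split.
      + exact: block (iota0 g).
      + exact: block (iota1 g).
      + exact: block (iota2 g).
      + by rewrite (D1P _ _ _ (iota0 g) (iota1 g)) !rhoK addrN.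
      + by rewrite (D2P _ _ _ (iota0 g) (iota2 g)) !rhoK addrN.
    pose x0 : X i0 := SigSub (mem_set (X0 : X i0 (w \o b0))).
    pose x1 : X i1 := SigSub (mem_set (X1 : X i1 (w \o b1))).
    pose x2 : X i2 := SigSub (mem_set (X2 : X i2 (w \o b2))).
    have e0 : x0 = rho i0 (pi i0 x0) by apply: pi_inj; rewrite rhoK.
    have e1 : x1 = rho i1 (- pi i0 x0).
      apply: pi_inj; rewrite rhoK; apply/eqP.
      rewrite -addr_eq0 addrC; apply/eqP.
      exact/(D1P w).
    have e2 : x2 = rho i2 (- pi i0 x0).
      apply: pi_inj; rewrite rhoK; apply/eqP.
      rewrite -addr_eq0 addrC; apply/eqP.
      exact/(D2P w).
    exists (pi i0 x0) => //; apply: functional_extensionality_dep => u.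
    case: (split_ordP u) => [l ->|v ->]; first by rewrite iota0 -e0.
    by case: (split_ordP v) => [l ->|l ->]; rewrite ?iota1 ?iota2 -?e1 -?e2.
  apply: cut_out_definable_as; first by exists (iota 0), 0.
  rewrite SE; do 2 (apply: cut_outI; last exact: definable_cut_out).
  have cutX i (b : 'I_(n i) -> 'I_k) :
      cut_out d A [set w : 'I_k -> N | X i (w \o b)].
    exact: (cut_out_subst (inl \o b) BA (definable_as_cut_out (defX i))).
  by do 2 (apply: cut_outI; last exact: cutX).
- split.
  (* zero: pi_0 x_0 = 0 *)
  + have [D [Dd DP]] := definable_sum1 b0; exists D; split=> // x.
    rewrite -[x]psiK (DP _ _ (iota0 (psi x))) rhoK zE.
    by split=> [/phi_inj|->].
  (* opposite: pi_1 x_1 + pi_2 y_2 = 0, that is - x - y = 0 *)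
  + have [D [Dd DP]] := @definable_sum2 _ i1 i2 (inl \o b1) (inr \o b2) isT.
    exists D; split=> // x y; rewrite -[x]psiK -[y]psiK.
    rewrite (DP _ _ _ (iota1 (psi x)) (iota2 (psi y))) !rhoK -opprD.
    rewrite -[in X in _ <-> X]oppr0.
    split=> [xy|/oppr_inj xy]; last first.
      by apply/eqP; rewrite eq_sym -addr_eq0 addrC phiD xy -zE.
    congr (- _); apply: phi_inj; rewrite -phiD -zE -xy; exact: (@addrN G').
  (* sum: pi_1 x_1 + pi_2 y_2 + pi_0 z_0 = 0, that is - x - y + z = 0 *)
  + have [D [Dd DP]] := @definable_sum3 _ i1 i2 i0 (inl \o inl \o b1)
      (inl \o inr \o b2) (inr \o b0) isT isT isT.
    exists D; split=> // x y z; rewrite -[x]psiK -[y]psiK -[z]psiK.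
    rewrite (DP _ _ _ _ (iota1 (psi x)) (iota2 (psi y)) (iota0 (psi z))).
    rewrite phiD !rhoK -opprD [X in _ <-> X = 0]addrC.
    split=> [/phi_inj ->|/eqP].
      exact: subrr.
    by rewrite subr_eq0 => /eqP ->.
(* pi_i x = g iff pi_i x + pi_j (pi_j^-1 (- g)) = 0, with j = 1 or 2 so that
   the block j of g codes - g, and j <> i *)
- have block i j (b : 'I_(n j) -> 'I_k) : i != j ->
      (forall g l, iota g (b l) = \val (rho j (- g)) l) ->
      definable_map A (Y := S) (fun x : X i => phi (pi i x)).
    move=> ij bP; have [D [Dd DP]] := definable_sum2 inl (inr \o b) ij.
    exists D; split=> // x y; rewrite -[y]psiK.
    rewrite (DP _ x _ _ (bP (psi y)))// rhoK.
    split=> [/phi_inj ->|/eqP]; first exact: subrr.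
    by rewrite subr_eq0 => /eqP ->.
  move=> i; have [->|ii1] := eqVneq i i1; first exact: (block i1 i2 b2).
  exact: (block i i1 b1).
- by move=> i; apply: bij_comp.
- split=> [a|i]; last by rewrite pi_e -zE.
  have phi_sum := big_morph (phi : G -> G')
    (id1 := 0) (op1 := +%R) (id2 := 0) (op2 := +%R)
    (fun g h => esym (phiD g h)) (esym zE).
  by rewrite Q_sum -phi_sum zE; split=> [->|/phi_inj].
Qed.
End SumRelations.

(** * Coordinatization by an abelian group *)

Theorem mainTheorem5 (m : nat) (hm : (4 <= m)%N) :
  (forall (X : 'I_m -> Type) (Q : set (forall i, X i)),
     (forall i, inhabited (X i)) -> P1 Q -> P2 Q ->
     exists (G : zmodType) (pi : forall i, X i -> G),
       (forall i, bijective (pi i)) /\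
       forall a : forall i, X i, Q a <-> \sum_(i < m) pi i (a i) = 0)
  /\
  (forall (L : language) (M N : fo_structure L) (j : M -> N),
     elementary_embedding j -> succ_saturated N M ->
   forall (n : 'I_m -> nat) (X : forall i, set ('I_(n i) -> N))
     (Q : set (forall i, X i)) (F : set ({i : 'I_m & 'I_(n i)} -> N)),
     (forall i, X i !=set0) -> P1 Q -> P2 Q ->
   forall d : definability,
     (forall i, definable_as d (range j) (X i)) ->
     definable (range j) F -> (forall a, Q a <-> F (concat a)) ->
   forall e : forall i, X i, Q e ->
   let A : set N := range j `|` range (concat e) in
   exists (k : nat) (S : set ('I_k -> N)) (cG : Algebra.Zmodule S),
     let G : zmodType := Algebra.Zmodule.Pack cG in
     exists pi : forall i, X i -> G,
       [/\ definable_as d A S,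
           relatively_definable_ops A cG,
           forall i, definable_map A (Y := S) (pi i),
           forall i, bijective (pi i)
         & (forall a : forall i, X i, Q a <-> \sum_(i < m) pi i (a i) = 0) /\
           (forall i, pi i (e i) = 0)]).
Proof.
pose o : 'I_m := Ordinal (leq_trans (isT : (1 <= 4)%N) hm).
split=> [X Q X0 p1 p2|L M N j _ _ n X Q F _ p1 p2 d defX defF QF e Qe A].
  have [e0 _] : exists e0 : forall i, X i, True.
    have X1 i : exists x : X i, True by have [x] := X0 i; exists x.
    by exists (fun i => projT1 (cid (X1 i))).
  (* a member of Q, to serve as base point *)
  have [x Qx] := complete p1 o e0.
  have [G [pi [pi_bij _ Q_sum]]] := group_of_relation hm p1 p2 Qx o.
  by exists G, pi.
have [G [pi [pi_bij pi_e Q_sum]]] := group_of_relation hm p1 p2 Qe o.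
have jA : range j `<=` A by move=> x; left.
have eA : range (concat e) `<=` A by move=> x; right.
exact: (definable_group jA defF QF eA pi_e Q_sum pi_bij
          (leq_trans (isT : (3 <= 4)%N) hm) defX).
Qed.
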